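(* Let $1\le p<\infty$, and let $q$ be determined by $1/p+1/q=1$ if $p>1$ and $q=\infty$ if $p=1$. Any continuous linear functional $x^*\in\ell_{p,\lim}^*$ can be uniquely represented in the form $$\langle x^*,x\rangle=\sum_{n\in\mathbb{N}}y_n(x_n-a)+\alpha a=\sum_{n\in\mathbb{N}}y_n x_n^0+\alpha a\qquad\text{for all } x=(x_n^0+a)_{n\in\mathbb{N}}\in\ell_{p,\lim},$$ with $y=(y_n)_{n\in\mathbb{N}}\in\ell_q$ and $\alpha\in\mathbb{R}$.
   Context: For $1\le p<\infty$, $$\ell_{p,\lim}=\{x=(x_n)_{n\in\mathbb{N}} \mid x_n=x_n^0+a,\ x^0=(x_n^0)_{n\in\mathbb{N}}\in\ell_p,\ a\in\mathbb{R}\},\qquad \|x\|^p_{\ell_{p,\lim}}=\|x^0\|^p_{\ell_p}+|a|^p,$$ where sequences are real; the representation $x_n=x_n^0+a$ is unique and $a=\lim_{n\to\infty}x_n$. $\ell_{p,\lim}^*$ denotes the topological dual. *)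

(* Defs.v *)
From HB Require Import structures.
From mathcomp Require Import all_boot all_order all_algebra.
From mathcomp Require Import all_classical all_reals all_analysis.
Set Implicit Arguments.
Unset Strict Implicit.
Unset Printing Implicit Defensive.
Import Order.TTheory GRing.Theory Num.Theory.
Import numFieldNormedType.Exports.
Local Open Scope classical_set_scope.
Local Open Scope ring_scope.

(* Real sequences with finite p-norm; p = +oo is allowed and gives the bounded
   sequences, since a null set of the counting measure is empty. *)
Definition ell (R : realType) (p : \bar R) : {pred nat -> R} :=
  Lfun (@counting nat R) p.

Definition ell_norm (R : realType) (p : \bar R) (x : nat -> R) : R :=
  fine ('N[@counting nat R]_p [EFin \o x])%E.

Definition in_ell_lim (R : realType) (p : R) : {pred nat -> R} :=
  mem [set x : nat -> R | exists x0 : nat -> R, exists a : R,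
    x0 \in ell p%:E /\ (forall n, x n = x0 n + a)].

(* The type carries the proof of 1 <= p, without which it is not normed. *)
Record ell_lim (R : realType) (p : R) (p1 : 1 <= p) := EllLim {
  ell_lim_val :> nat -> R ;
  _ : ell_lim_val \in in_ell_lim p
}.

Section ell_theory.
Context {R : realType} {p : R} (p1 : 1 <= p).
Implicit Types (x y : nat -> R) (a : R).

Let p0 : 0 < p. Proof. exact: lt_le_trans ltr01 p1. Qed.
Let pe1 : (1 <= p%:E)%E. Proof. by rewrite lee_fin. Qed.
Let S x := (\sum_(0 <= n <oo) (`|x n| `^ p)%:E)%E.

Let S_term_ge0 x n : (0 <= (`|x n| `^ p)%:E)%E.
Proof. by rewrite lee_fin powR_ge0. Qed.

Let S_ge0 x : (0 <= S x)%E.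
Proof. by apply: nneseries_ge0 => n _ _; exact: S_term_ge0. Qed.

Let normE x : ('N[@counting nat R]_(p%:E) [EFin \o x] = S x `^ p^-1)%E.
Proof. by rewrite Lnorm_counting. Qed.

Lemma in_ellE x : (x \in ell p%:E) = (S x < +oo)%E.
Proof.
have -> : (x \in ell p%:E) =
    ('N[@counting nat R]_(p%:E) [EFin \o x] < +oo)%E.
  rewrite /ell inE/= /finLfun; apply/idP/idP.
    by case/andP => _; rewrite inE.
  by move=> h; apply/andP; split; rewrite inE.
rewrite normE; apply/idP/idP; last exact: poweR_lty.
by apply: lty_poweRy; rewrite invr_eq0 gt_eqF.
Qed.

Let S_fin x : x \in ell p%:E -> S x \is a fin_num.
Proof. by rewrite in_ellE => xS; rewrite ge0_fin_numE. Qed.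

Lemma ell_norm_powR x : ell_norm p%:E x `^ p = fine (S x).
Proof.
by rewrite /ell_norm normE -fine_poweR -poweRrM mulVf ?gt_eqF// poweRe1.
Qed.

Lemma ell_cvg0 x : x \in ell p%:E -> x @ \oo --> (0 : R).
Proof.
move=> xp; have xS := xp; rewrite in_ellE in xS.
have cS := nneseries_tail_cvg xS (fun k _ => S_term_ge0 x k).
apply/cvgr0Pnorm_lt => e e0.
have ep : (0 < (e `^ p)%:E)%E by rewrite lte_fin powR_gt0.
have : \forall n \near \oo,
    (\sum_(n <= k <oo) (`|x k| `^ p)%:E < (e `^ p)%:E)%E.
  exact: (cS [set y | (y < (e `^ p)%:E)%E] (open_ereal_lt' ep)).
apply: filterS => n tn; rewrite ltNge; apply/negP => en.
move: tn; apply/negP; rewrite -leNgt.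
apply: (@le_trans _ _ (`|x n| `^ p)%:E).
  by rewrite lee_fin ge0_ler_powR// ?nnegrE ?(ltW p0) ?(ltW e0).
have := @nneseries_lim_ge _ (fun k => (`|x k| `^ p)%:E) xpredT n n.+1
  (fun k _ _ => S_term_ge0 x k).
by rewrite big_nat1.
Qed.

Lemma ell_lim_cvg x x0 a : x0 \in ell p%:E -> (forall n, x n = x0 n + a) ->
  x @ \oo --> a.
Proof.
move=> x0p xE; have -> : x = (fun n => x0 n + a) by apply/funext.
by rewrite -[X in _ --> X]add0r; apply: cvgD; [exact: ell_cvg0|exact: cvg_cst].
Qed.

Lemma ell_submod_closed : submod_closed (ell (p%:E : \bar R)).
Proof. exact: Lfun_submod_closed. Qed.

Lemma in_ell_lim_submod_closed : submod_closed (in_ell_lim p).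
Proof.
have [ell0 ellD] := ell_submod_closed.
split.
  rewrite inE/=; exists 0, 0; split; first exact: ell0.
  by move=> n; rewrite addr0.
move=> k x y; rewrite !inE/= => -[x0 [a [x0p xE]]] [y0 [b [y0p yE]]].
exists (k *: x0 + y0), (k * a + b); split; first exact: ellD.
by move=> n; rewrite !fctE/= xE yE scalerDr addrACA.
Qed.

HB.instance Definition _ := GRing.isSubmodClosed.Build _ _ (in_ell_lim p)
  in_ell_lim_submod_closed.

HB.instance Definition _ := [isSub for @ell_lim_val R p p1].
HB.instance Definition _ := [Choice of ell_lim p1 by <:].
HB.instance Definition _ := [SubChoice_isSubLmodule of ell_lim p1 by <:].


Definition ell_lim_norm (x : ell_lim p1) : R :=
  let a := limn x in
  (ell_norm p%:E (fun n => x n - a) `^ p + `|a| `^ p) `^ p^-1.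

Lemma ell_lim_repr (x : ell_lim p1) (x0 : nat -> R) a :
  x0 \in ell p%:E -> (forall n, x n = x0 n + a) ->
  limn x = a /\ (fun n => x n - limn x) = x0.
Proof.
move=> x0p xE; have xa : limn x = a by apply: cvg_lim => //; exact: ell_lim_cvg xE.
by split=> //; apply/funext => n; rewrite xa xE addrK.
Qed.

Lemma ell_lim_reprE (x : ell_lim p1) :
  (fun n => x n - limn x) \in ell p%:E.
Proof.
have := valP x; rewrite inE/= => -[x0 [a [x0p xE]]].
by have [_ ->] := ell_lim_repr x0p xE.
Qed.

Lemma ell_lim_normE (x : ell_lim p1) (x0 : nat -> R) a :
  x0 \in ell p%:E -> (forall n, x n = x0 n + a) ->
  ell_lim_norm x `^ p = ell_norm p%:E x0 `^ p + `|a| `^ p.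
Proof.
move=> x0p xE; have [xa xx0] := ell_lim_repr x0p xE.
rewrite /ell_lim_norm xx0 xa -powRrM mulVf ?gt_eqF// powRr1//.
by rewrite addr_ge0 ?powR_ge0.
Qed.

(* ell_lim p is isometric to ell p via x |-> (a, x^0_0, x^0_1, ...). *)
Let cons a x n := if n is n'.+1 then x n' else a.

Let S_cons a x : S (cons a x) = ((`|a| `^ p)%:E + S x)%E.
Proof.
rewrite /S (nneseries_recl (fun k _ => S_term_ge0 (cons a x) k) isT).
congr (_ + _)%E.
rewrite -(nneseries_addn 1 (S_term_ge0 (cons a x))).
by under eq_eseriesr do rewrite addn1.
Qed.

Let code (x : ell_lim p1) := cons (limn x) (fun n => x n - limn x).

Let code_in (x : ell_lim p1) : code x \in ell p%:E.
Proof.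
rewrite in_ellE S_cons lte_add_pinfty ?ltry// -in_ellE.
exact: ell_lim_reprE.
Qed.

Let ell_lim_norm_code (x : ell_lim p1) : ell_lim_norm x = ell_norm p%:E (code x).
Proof.
rewrite /ell_lim_norm ell_norm_powR [RHS]/ell_norm normE S_cons fine_poweR.
rewrite fineD ?S_fin ?ell_lim_reprE//.
by rewrite addrC.
Qed.

Let ell_lim_is_cvg (x : ell_lim p1) : cvgn x.
Proof.
have := valP x; rewrite inE/= => -[x0 [a [x0p xE]]].
by apply/cvg_ex; exists a; exact: ell_lim_cvg xE.
Qed.

Let codeD (x y : ell_lim p1) : code (x + y) = (code x \+ code y)%R.
Proof.
have xyl : limn (x + y : ell_lim p1) = limn x + limn y.
  apply: cvg_lim => //.
  exact: (cvgD (@ell_lim_is_cvg x) (@ell_lim_is_cvg y)).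
apply/funext => -[|n] /=; rewrite ?xyl//.
by rewrite opprD addrACA.
Qed.

Let codeZ k (x : ell_lim p1) : code (k *: x) = k \*: code x.
Proof.
have xl : limn (k *: x : ell_lim p1) = k * limn x.
  apply: cvg_lim => //.
  have -> : (k *: x : ell_lim p1) = (fun n => k * x n) :> (nat -> R) by [].
  exact: cvgMl_tmp (@ell_lim_is_cvg x).
apply/funext => -[|n] /=; rewrite ?xl//.
by rewrite [RHS]mulrBr.
Qed.

Let ell_normK x : x \in ell p%:E ->
  (ell_norm p%:E x)%:E = ('N[@counting nat R]_(p%:E) [EFin \o x])%E.
Proof.
move=> xp; rewrite /ell_norm fineK// normE.
by rewrite fin_num_poweR// S_fin.
Qed.

Lemma ler_ell_lim_normD (x y : ell_lim p1) :
  ell_lim_norm (x + y) <= ell_lim_norm x + ell_lim_norm y.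
Proof.
rewrite !ell_lim_norm_code -lee_fin EFinD !ell_normK ?code_in// codeD.
exact: eminkowski.
Qed.

Lemma ell_lim_normZ k (x : ell_lim p1) :
  ell_lim_norm (k *: x) = `|k| * ell_lim_norm x.
Proof.
rewrite !ell_lim_norm_code; apply: EFin_inj.
rewrite EFinM !ell_normK ?code_in// codeZ.
exact: (@LnormZ _ _ _ _ _ pe1 (Lfun_Sub pe1 (code_in x))).
Qed.

Lemma ell_lim_norm_eq0 (x : ell_lim p1) : ell_lim_norm x = 0 -> x = 0.
Proof.
move=> x_eq0; have [x0p xE] : (fun n => x n - limn x) \in ell p%:E /\
    (forall n, x n = (fun n => x n - limn x) n + limn x).
  by split; [exact: ell_lim_reprE|move=> n; rewrite subrK].
have /esym/eqP := ell_lim_normE x0p xE.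
rewrite x_eq0 powR0 ?lt0r_neq0// paddr_eq0 ?powR_ge0// => /andP[].
move=> /eqP; rewrite ell_norm_powR => Sx0 /eqP/powR_eq0_eq0/normr0_eq0 x_lim0.
have Sx : S (fun n => x n - limn x) = 0%E by rewrite -[LHS]fineK ?S_fin// Sx0.
have term_le0 n : ((`|x n - limn x| `^ p)%:E <= 0)%E.
  rewrite -Sx.
  have := @nneseries_lim_ge _ (fun k => (`|x k - limn x| `^ p)%:E) xpredT 0 n.+1
    (fun k _ _ => S_term_ge0 (fun k => x k - limn x) k).
  apply: le_trans; rewrite big_nat_recr//= leeDr//; apply: sume_ge0 => i _.
  by rewrite lee_fin powR_ge0.
apply/val_inj/funext => n /=; apply/normr0_eq0/(@powR_eq0_eq0 _ _ p)/eqP.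
by rewrite eq_le powR_ge0 andbT -lee_fin -[x n]subr0 -[X in x n - X]x_lim0.
Qed.

HB.instance Definition _ := Lmodule_isNormed.Build R (ell_lim p1)
  ler_ell_lim_normD ell_lim_normZ ell_lim_norm_eq0.

End ell_theory.

Lemma ell_lim_normrE (R : realType) (p : R) (p1 : 1 <= p) (x : ell_lim p1)
    (x0 : nat -> R) (a : R) :
  x0 \in ell p%:E -> (forall n, x n = x0 n + a) ->
  `|x| `^ p = ell_norm p%:E x0 `^ p + `|a| `^ p.
Proof. exact: ell_lim_normE. Qed.

(* Main.v *)
Require Import Defs.
From HB Require Import structures.
From mathcomp Require Import all_boot all_order all_algebra.
From mathcomp Require Import all_classical all_reals all_analysis.
From mathcomp Require Import ring.
Set Implicit Arguments.
Unset Strict Implicit.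
Unset Printing Implicit Defensive.
Import Order.TTheory GRing.Theory Num.Theory.
Import numFieldNormedType.Exports.
Local Open Scope classical_set_scope.
Local Open Scope ring_scope.

(** Every x = x0 + a in ell_{p,lim} is the norm limit of
    sum_(i < n) x0_i e_i + a 1, where e_i is the i-th unit sequence and 1 the
    constant one: the p-th power of the distance is the tail
    sum_(k >= n) |x0_k|^p ([ell_lim_trunc_cvg]). A continuous linear f therefore
    satisfies f x = sum_n f(e_n) x0_n + a f(1) ([functional_series]), which
    gives the representation with y_n = f(e_n) and alpha = f(1). Evaluating any other
    representation at the e_n and at 1 forces the same coefficients.

    It remains to see that y lies in ell_q, which uses the bound
    |f x| <= M |x|. For p = 1 the vectors e_n have norm 1, so |y_n| <= M
    ([functional_ell_infty]). For 1 < p with conjugate exponent r, f is tested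
    on the truncations of z_k = sg(y_k) |y_k|^(r - 1), the equality case of
    Hoelder's inequality. Since y_k z_k = |y_k|^r = |z_k|^p, the value of f and
    the p-th power of the norm N of the n-th truncation are both
    sum_(k < n) |y_k|^r; hence N^p <= M N, and N^p <= M^r for all n
    ([functional_ell_conjugate]). *)

Section finite_support.
Context {R : realType} {p : R} (p1 : 1 <= p).
Implicit Types (x z : nat -> R) (n : nat).

Let p0 : 0 < p. Proof. exact: lt_le_trans ltr01 p1. Qed.

Let term_ge0 x n : (0 <= (`|x n| `^ p)%:E)%E.
Proof. by rewrite lee_fin powR_ge0. Qed.

Lemma ell_bounded_sums x (C : R) :
  (forall n, \sum_(0 <= k < n) `|x k| `^ p <= C) -> x \in ell p%:E.
Proof.
move=> xC; rewrite (in_ellE p1).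
apply: (@le_lt_trans _ _ C%:E); last exact: ltry.
apply: lime_le; first by apply: is_cvg_nneseries => n _ _; exact: term_ge0.
by apply: nearW => n; rewrite sumEFin lee_fin.
Qed.

Lemma nneseries_finite_support x n : (forall k, (n <= k)%N -> x k = 0) ->
  (\sum_(0 <= k <oo) (`|x k| `^ p)%:E)%E = (\sum_(0 <= k < n) `|x k| `^ p)%:E.
Proof.
move=> x0; rewrite (nneseries_split 0 n) => [|k _]; last exact: term_ge0.
rewrite add0n sumEFin [X in (_ + X)%E]eseries0 ?adde0// => k nk _.
by rewrite x0// normr0 powR0// gt_eqF.
Qed.

Lemma ell_finite_support x n : (forall k, (n <= k)%N -> x k = 0) ->
  x \in ell p%:E.
Proof.
by move=> x0; rewrite (in_ellE p1) (nneseries_finite_support x0) ltry.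
Qed.

Lemma ell_in_lim x a : x \in ell p%:E -> (fun n => x n + a) \in in_ell_lim p.
Proof. by move=> xp; rewrite inE/=; exists x, a. Qed.

Lemma ell_delta (i : nat) : (fun n => (n == i)%:R : R) \in ell p%:E.
Proof.
by apply: (@ell_finite_support _ i.+1) => k; case: eqP => // ->; rewrite ltnn.
Qed.

Definition ell_lim_delta (i : nat) : ell_lim p1 :=
  EllLim p1 (ell_in_lim 0 (ell_delta i)).

Lemma ell_lim_deltaE i n : ell_lim_delta i n = (n == i)%:R.
Proof. exact: addr0. Qed.

Lemma ell_zero : (fun=> 0 : R) \in ell p%:E.
Proof. exact: (@ell_finite_support _ 0). Qed.

Definition ell_lim_one : ell_lim p1 := EllLim p1 (ell_in_lim 1 ell_zero).

Lemma ell_lim_oneE n : ell_lim_one n = 1.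
Proof. exact: add0r. Qed.

(** A linear combination of unit sequences rather than a sequence given by
    cases, so that linear maps can be computed on it; [ell_lim_truncE] recovers
    the sequence. *)
Definition ell_lim_trunc z n : ell_lim p1 :=
  \sum_(0 <= i < n) z i *: ell_lim_delta i.

Lemma ell_lim_truncE z n k : ell_lim_trunc z n k = if (k < n)%N then z k else 0.
Proof.
rewrite /ell_lim_trunc; elim: n => [|n IHn]; first by rewrite big_geq.
rewrite big_nat_recr//=.
transitivity ((\sum_(0 <= i < n) z i *: ell_lim_delta i : ell_lim p1) k +
  z n * ell_lim_delta n k);
  first by [].
rewrite IHn ell_lim_deltaE ltnS [(k <= n)%N]leq_eqVlt.
by case: eqVneq => [->|_] /=; rewrite ?ltnn ?mulr1 ?mulr0 ?add0r ?addr0.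
Qed.

Lemma ell_lim_trunc_ell z n : (ell_lim_trunc z n : nat -> R) \in ell p%:E.
Proof.
by apply: (@ell_finite_support _ n) => k nk; rewrite ell_lim_truncE ltnNge nk.
Qed.

(** The limit component a is 0 for a sequence in ell_p. *)
Lemma norm_ell_lim (x : ell_lim p1) : (x : nat -> R) \in ell p%:E ->
  `|x| `^ p = fine (\sum_(0 <= k <oo) (`|x k| `^ p)%:E)%E.
Proof.
move=> xp; rewrite (ell_lim_normrE xp (a := 0)) => [|n]; last by rewrite addr0.
by rewrite (ell_norm_powR p1) normr0 powR0 ?gt_eqF// addr0.
Qed.

Lemma norm_ell_lim_trunc z n :
  `|ell_lim_trunc z n| `^ p = \sum_(0 <= k < n) `|z k| `^ p.
Proof.
rewrite (norm_ell_lim (ell_lim_trunc_ell z n)).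
rewrite (@nneseries_finite_support _ n)/=; last first.
  by move=> k nk; rewrite ell_lim_truncE ltnNge nk.
by apply: eq_big_nat => k /andP[_ kn]; rewrite ell_lim_truncE kn.
Qed.

(** The difference vanishes below n and equals x0 from n on, so the p-th power
    of its norm is a tail of a convergent series. This is where p < +oo
    matters: finitely supported sequences are not dense among the bounded
    ones. *)
Lemma ell_lim_trunc_cvg (x : ell_lim p1) x0 a : x0 \in ell p%:E ->
  (forall n, x n = x0 n + a) ->
  ell_lim_trunc x0 n + a *: ell_lim_one @[n --> \oo] --> x.
Proof.
move=> x0p xE; have x0S := x0p; rewrite (in_ellE p1) /= in x0S.
have tail0 := nneseries_tail_cvg x0S (fun k _ => term_ge0 x0 k).
apply/cvgrPdist_lt => e e0.
have ep : (0 < (e `^ p)%:E)%E by rewrite lte_fin powR_gt0.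
have : \forall n \near \oo,
    (\sum_(n <= k <oo) (`|x0 k| `^ p)%:E < (e `^ p)%:E)%E.
  exact: (tail0 [set y | (y < (e `^ p)%:E)%E] (open_ereal_lt' ep)).
apply: filterS => n tn.
have dE k : (x - (ell_lim_trunc x0 n + a *: ell_lim_one) : ell_lim p1) k =
    if (k < n)%N then 0 else x0 k.
  transitivity (x k - (ell_lim_trunc x0 n k + a * ell_lim_one k)); first by [].
  rewrite xE ell_lim_truncE ell_lim_oneE mulr1 opprD addrACA subrr addr0.
  by case: ifP => _; rewrite ?subrr ?subr0.
have SE : (\sum_(0 <= k <oo)
    (`|(x - (ell_lim_trunc x0 n + a *: ell_lim_one) : ell_lim p1) k| `^ p)%:E =
    \sum_(n <= k <oo) (`|x0 k| `^ p)%:E)%E.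
  rewrite (nneseries_split 0 n) => [|k _]; last exact: term_ge0.
  rewrite add0n big_nat big1 ?add0e => [|k /andP[_ kn]]; last first.
    by rewrite dE kn normr0 powR0// gt_eqF.
  rewrite [LHS]eseries_cond [RHS]eseries_cond; apply: eq_eseriesr => k nk.
  by rewrite dE; move: nk; rewrite andTb ltnNge => ->.
(* From here on the p-th powers of the distance and of e are compared. *)
rewrite ltNge; apply/negP => /(ge0_ler_powR (ltW p0)).
rewrite !nnegrE normr_ge0 (ltW e0) => /(_ isT isT).
rewrite norm_ell_lim; last by rewrite (in_ellE p1)/= SE (lt_trans tn)// ltry.
rewrite SE leNgt => /negP; apply.
rewrite -lte_fin fineK// ge0_fin_numE ?(lt_trans tn (ltry _))//.
by apply: nneseries_ge0 => k _ _; exact: term_ge0.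
Qed.

End finite_support.

Lemma ell_infty_bounded (R : realType) (x : nat -> R) (C : R) :
  (forall n, `|x n| <= C) -> x \in ell +oo%E.
Proof.
move=> xC; rewrite /ell inE/= /finLfun.
apply/andP; split; rewrite inE//=.
rewrite /finite_norm Lnorm.unlock; case: ifPn => _; last exact: ltry.
apply: (@le_lt_trans _ _ C%:E); last exact: ltry.
by apply/ess_sup_inf.ess_supP/aeW => n /=; rewrite lee_fin.
Qed.

Section functional.
Context {R : realType} {p : R} {p1 : 1 <= p} (f : {linear ell_lim p1 -> R^o}).

Lemma linear_ell_lim_trunc z n :
  f (ell_lim_trunc p1 z n) = series (fun k => f (ell_lim_delta p1 k) * z k) n.
Proof.
rewrite /ell_lim_trunc linear_sum seriesEnat /=; apply: eq_bigr => k _.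
by rewrite linearZ/= [LHS]mulrC.
Qed.

Hypothesis f_cont : continuous f.

Lemma functional_series (x : ell_lim p1) x0 a : x0 \in ell p%:E ->
  (forall n, x n = x0 n + a) ->
  series (fun k => f (ell_lim_delta p1 k) * x0 k) @ \oo -->
    f x - f (ell_lim_one p1) * a.
Proof.
move=> x0p xE.
have fx : f (ell_lim_trunc p1 x0 n + a *: ell_lim_one p1) @[n --> \oo] --> f x.
  by apply: continuous_cvg; [exact: f_cont|exact: ell_lim_trunc_cvg].
have -> : series (fun k => f (ell_lim_delta p1 k) * x0 k) =
    (fun n => f (ell_lim_trunc p1 x0 n + a *: ell_lim_one p1) -
      f (ell_lim_one p1) * a).
  apply/funext => n.
  by rewrite linearD linearZ/= linear_ell_lim_trunc mulrC addrK.
by apply: cvgB => //; exact: cvg_cst.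
Qed.

Lemma functional_bound : exists M : R, forall x, `|f x| <= M * `|x|.
Proof.
have /linear_boundedP fM := @continuous_linear_bounded _ _ _ 0 f (@f_cont 0).
near (+oo : set_system R) => M; exists M; near: M; exact: fM.
Unshelve. all: by end_near. Qed.

(** The p-th power N^p of the norm of a truncated test vector equals the partial
    sum of |y_k|^r that has to be bounded, while boundedness of the functional
    gives N^p <= M N. Then N^(p - 1) <= M, and raising to the power r, where
    (p - 1) r = p, bounds the partial sum by M^r. *)
Lemma functional_ell_conjugate (r : R) : 1 < p -> p^-1 + r^-1 = 1 ->
  (fun n => f (ell_lim_delta p1 n)) \in ell r%:E.
Proof.
move=> p_gt1 pr; have [M fM] := functional_bound.
have p0 : 0 < p := lt_trans ltr01 p_gt1.
have pm1 : 0 < p - 1 by rewrite subr_gt0.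
have rE : r = p / (p - 1).
  apply: invr_inj; rewrite invf_div mulrBl mul1r mulfV ?gt_eqF//.
  by rewrite -pr addrAC subrr add0r.
have r1 : 1 <= r by rewrite rE ler_pdivlMr// mul1r gerBl.
have r0 : 0 < r := lt_le_trans ltr01 r1.
have rp : (r - 1) * p = r.
  by rewrite rE; field; rewrite gt_eqF.
set y := fun n => _; apply: (ell_bounded_sums r1 (C := M `^ r)) => n.
pose z k := Num.sg (y k) * `|y k| `^ (r - 1).
have normz k : `|z k| `^ p = `|y k| `^ r.
  have [yk0|yk0] := eqVneq (y k) 0.
    by rewrite /z yk0 sgr0 mul0r normr0 !powR0// gt_eqF.
  rewrite normrM normr_sg yk0 mul1r ger0_norm ?powR_ge0//.
  by rewrite -powRrM rp.
have yz k : y k * z k = `|y k| `^ r.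
  by rewrite /z mulrA (mulrC (y k)) -normrEsg mulr_powRB1.
set N := `|ell_lim_trunc p1 z n|.
have NE : N `^ p = \sum_(0 <= k < n) `|y k| `^ r.
  by rewrite norm_ell_lim_trunc; apply: eq_bigr => k _; exact: normz.
have fz : f (ell_lim_trunc p1 z n) = N `^ p.
  rewrite linear_ell_lim_trunc NE seriesEnat.
  by apply: eq_bigr => k _; exact: yz.
have NM : N `^ p <= M * N.
  by rewrite -fz; apply: le_trans (ler_norm _) (fM _).
rewrite -NE; have [->|N0] := eqVneq N 0.
  by rewrite powR0 ?powR_ge0// gt_eqF.
have {N0}N0 : 0 < N by rewrite lt_neqAle eq_sym N0 normr_ge0.
have NM' : N `^ (p - 1) <= M.
  by rewrite -(ler_pM2r N0) mulrC mulr_powRB1// ltW.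
have <- : (p - 1) * r = p by rewrite rE mulrC divfK// gt_eqF.
rewrite powRrM ge0_ler_powR ?nnegrE ?(ltW r0) ?powR_ge0//.
by rewrite (le_trans _ NM') ?powR_ge0.
Qed.

(** Each unit sequence has norm 1, so the operator bound M applies to its
    image directly. *)
Lemma functional_ell_infty :
  p = 1 -> (fun n => f (ell_lim_delta p1 n)) \in ell +oo%E.
Proof.
move=> pE; have [M fM] := functional_bound.
apply: (@ell_infty_bounded _ _ M) => n; apply: le_trans (fM _) _.
suff -> : `|ell_lim_delta p1 n| = 1 by rewrite mulr1.
have dp : (ell_lim_delta p1 n : nat -> R) \in ell p%:E.
  have -> : ell_lim_delta p1 n = (fun k => (k == n)%:R) :> (nat -> R).
    by apply/funext => k; rewrite ell_lim_deltaE.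
  exact: ell_delta.
have := norm_ell_lim dp.
rewrite (@nneseries_finite_support _ _ p1 _ n.+1) => [|k nk]; last first.
  by rewrite ell_lim_deltaE gtn_eqF.
rewrite /= big_nat_recr//= big_nat big1 => [|k /andP[_ kn]]; last first.
  by rewrite addr0 ltn_eqF// normr0 powR0// pE oner_eq0.
by rewrite addr0 eqxx normr1 powR1 add0r [X in _ `^ X]pE powRr1.
Qed.

End functional.

Theorem lemma6p1 (R : realType) (p : R) (p1 : 1 <= p) (q : \bar R)
    (q_fin : 1 < p -> exists2 r : R, q = r%:E & p^-1 + r^-1 = 1)
    (q_infty : p = 1 -> q = +oo%E)
    (f : {linear ell_lim p1 -> R^o}) (f_cont : continuous f) :
  exists! yalpha : (nat -> R) * R,
    let: (y, alpha) := yalpha in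
    y \in ell q /\
    forall (x : ell_lim p1) (x0 : nat -> R) (a : R),
      x0 \in ell p%:E -> (forall n, x n = x0 n + a) ->
      [/\ cvgn (series (fun n => y n * (x n - a))),
          f x = limn (series (fun n => y n * (x n - a))) + alpha * a
        & f x = limn (series (fun n => y n * x0 n)) + alpha * a].
Proof.
exists (fun n => f (ell_lim_delta p1 n), f (ell_lim_one p1)).
split=> [|[y alpha] [_ yE]].
  split.
    have [p_gt1|p_le1] := ltP 1 p.
      have [r -> pr] := q_fin p_gt1.
      exact: functional_ell_conjugate.
    have pE : p = 1 by apply/eqP; rewrite eq_le p_le1.
    by rewrite q_infty//; exact: functional_ell_infty.
  move=> x x0 a x0p xE.
  have -> : (fun n => f (ell_lim_delta p1 n) * (x n - a)) =
      (fun n => f (ell_lim_delta p1 n) * x0 n).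
    by apply/funext => n; rewrite xE addrK.
  have fxE := functional_series f_cont x0p xE.
  have fx : f x = limn (series (fun n => f (ell_lim_delta p1 n) * x0 n)) +
      f (ell_lim_one p1) * a.
    by rewrite (cvg_lim _ fxE)// subrK.
  by split=> //; apply/cvg_ex; exists (f x - f (ell_lim_one p1) * a).
congr (_, _).
  apply/funext => n.
  have [_ _ ->] := yE (ell_lim_delta p1 n) _ 0 (ell_delta p1 n) (fun=> erefl).
  rewrite mulr0 addr0; apply: cvg_lim => //.
  (* From index n + 1 on, the only nonzero term of the partial sum is y n. *)
  apply: cvg_near_cst; exists n.+1 => //= m nm.
  rewrite seriesEnat/= (bigD1_seq n) ?mem_index_iota ?iota_uniq//=.
  by rewrite eqxx mulr1 big1 ?addr0// => k /negPf ->; rewrite mulr0.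
have [_ _ ->] := yE (ell_lim_one p1) _ 1 (ell_zero p1) (fun=> erefl).
(* The sequence 1 has zero ell_p part, so only alpha remains. *)
rewrite mulr1 [X in X + _](_ : _ = 0) ?add0r//.
apply: cvg_lim => //; apply: cvg_near_cst; apply: nearW => n.
by rewrite seriesEnat/= big1// => k _; rewrite mulr0.
Qed.
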